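(* Let $(\mathcal{C},\mathbb{E},\mathfrak{s})$ be a skeletally small extriangulated category. Then the map $\mathbb{F}\mapsto\mathsf{def}\,\mathbb{F}$ gives an isomorphism of the following posets, where the poset structures are given by inclusion: (1) the poset of closed subbifunctors of $\mathbb{E}$; (2) the poset of Serre subcategories of $\mathsf{def}\,\mathbb{E}$.
   Context: Conventions: all categories and functors are additive; all subcategories are additive, full and closed under isomorphisms. $\mathcal{A}b$ is the category of abelian groups. Extriangulated categories (Nakaoka--Palu). Let $\mathcal{C}$ be an additive category and $\mathbb{E}\colon\mathcal{C}^{\mathrm{op}}\times\mathcal{C}\to\mathcal{A}b$ an additive bifunctor. For $\delta\in\mathbb{E}(C,A)$, $a\colon A\to A'$, $c\colon C'\to C$ write $a_*\delta=\mathbb{E}(\mathrm{id}_C,a)(\delta)$ and $c^*\delta=\mathbb{E}(c,\mathrm{id}_A)(\delta)$. For $\delta_i\in\mathbb{E}(C_i,A_i)$ ($i=1,2$), a morphism $(a,c)\colon\delta_1\to\delta_2$ is a pair $a\colon A_1\to A_2$, $c\colon C_1\to C_2$ with $a_*\delta_1=c^*\delta_2$. The element $\delta_1\oplus\delta_2\in\mathbb{E}(C_1\oplus C_2,A_1\oplus A_2)$ is the one with components $(\delta_1,0,0,\delta_2)$. Two complexes $A\xrightarrow{x}B\xrightarrow{y}C$ and $A\xrightarrow{x'}B'\xrightarrow{y'}C$ are equivalent if there is an isomorphism $b\colon B\to B'$ with $bx=x'$, $y'b=y$. Let $\mathfrak{s}$ assign to each $\delta\in\mathbb{E}(C,A)$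 an equivalence class $\mathfrak{s}(\delta)=[A\to B\to C]$; every complex in this class is said to realize $\delta$. $\mathfrak{s}$ is a realization if for every morphism $(a,c)\colon\delta_1\to\delta_2$ and all complexes $A_i\xrightarrow{x_i}B_i\xrightarrow{y_i}C_i$ realizing $\delta_i$ there is $b\colon B_1\to B_2$ with $bx_1=x_2a$, $y_2b=cy_1$. It is additive if $\mathfrak{s}(0)=[A\to A\oplus C\to C]$ (canonical inclusion and projection) for $0\in\mathbb{E}(C,A)$, and $\mathfrak{s}(\delta_1\oplus\delta_2)=\mathfrak{s}(\delta_1)\oplus\mathfrak{s}(\delta_2)$. The triple $(\mathcal{C},\mathbb{E},\mathfrak{s})$ is an extriangulated category (and $(\mathbb{E},\mathfrak{s})$ an extriangulated structure on $\mathcal{C}$) if $\mathfrak{s}$ is an additive realization and: (ET3) if $A_i\xrightarrow{x_i}B_i\xrightarrow{y_i}C_i$ realize $\delta_i$ ($i=1,2$) and $a\colon A_1\to A_2$, $b\colon B_1\to B_2$ satisfy $bx_1=x_2a$, then there is $c\colon C_1\to C_2$ with $cy_1=y_2b$ and $a_*\delta_1=c^*\delta_2$; (ET3)$^{\mathrm{op}}$ if instead $b$, $c$ are given with $cy_1=y_2b$, then there is $a$ with $bx_1=x_2a$ and $a_*\delta_1=c^*\delta_2$; (ET4) if $A\xrightarrow{f}B\xrightarrow{f'}D$ realizes $\delta\in\mathbb{E}(D,A)$ and $B\xrightarrow{g}C\xrightarrow{g'}F$ realizes $\delta'\in\mathbb{E}(F,B)$, then there are an object $G$, morphisms $h=gf\colon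 A\to C$, $h'\colon C\to G$, $d\colon D\to G$, $e\colon G\to F$ with $h'g=df'$, $eh'=g'$, and $\delta''\in\mathbb{E}(G,A)$ realized by $A\xrightarrow{h}C\xrightarrow{h'}G$, such that $D\xrightarrow{d}G\xrightarrow{e}F$ realizes $f'_*\delta'$, $d^*\delta''=\delta$, and $f_*\delta''=e^*\delta'$; (ET4)$^{\mathrm{op}}$ if $D\xrightarrow{f'}A\xrightarrow{f}B$ realizes $\delta\in\mathbb{E}(B,D)$ and $F\xrightarrow{g'}B\xrightarrow{g}C$ realizes $\delta'\in\mathbb{E}(C,F)$, then there are an object $G$, morphisms $d\colon D\to G$, $e\colon G\to F$, $h'\colon G\to A$, $h=gf\colon A\to C$ with $h'd=f'$, $fh'=g'e$, and $\delta''\in\mathbb{E}(C,G)$ realized by $G\xrightarrow{h'}A\xrightarrow{h}C$, such that $D\xrightarrow{d}G\xrightarrow{e}F$ realizes $g'^*\delta$, $e_*\delta''=\delta'$, and $d_*\delta=g^*\delta''$. A complex $A\xrightarrow{x}B\xrightarrow{y}C$ realizing some $\delta\in\mathbb{E}(C,A)$ is an $\mathfrak{s}$-conflation, and then $y$ is an $\mathfrak{s}$-deflation. Closed subbifunctors. An additive subbifunctor $\mathbb{F}$ of $\mathbb{E}$ (subgroups $\mathbb{F}(C,A)\subset\mathbb{E}(C,A)$ stable under all $a_*$ and $c^*$) is closed if $\mathfrak{s}|_{\mathbb{F}}$-deflations are closed under composition, where an $\mathfrak{s}|_{\mathbb{F}}$-deflation is a morphism $y$ occurring in a complex $A\to B\xrightarrow{y}C$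 that realizes some $\delta\in\mathbb{F}(C,A)$. (Equivalently, $(\mathbb{F},\mathfrak{s}|_{\mathbb{F}})$ is an extriangulated structure on $\mathcal{C}$.) Modules. For a skeletally small additive category $\mathcal{C}$, $\mathsf{Mod}\,\mathcal{C}$ is the abelian category of right $\mathcal{C}$-modules, i.e. additive functors $\mathcal{C}^{\mathrm{op}}\to\mathcal{A}b$. $M$ is finitely generated if there is a surjection $\mathcal{C}(-,C)\to M$ with $C\in\mathcal{C}$; finitely presented if there is an exact sequence $\mathcal{C}(-,B)\to\mathcal{C}(-,C)\to M\to0$ with $B,C\in\mathcal{C}$; coherent if it is finitely presented and every finitely generated submodule is finitely presented. $\mathsf{coh}\,\mathcal{C}\subset\mathsf{Mod}\,\mathcal{C}$ is the subcategory of coherent modules; it is closed under kernels, cokernels and extensions in $\mathsf{Mod}\,\mathcal{C}$, hence abelian. Defects. For $\delta\in\mathbb{E}(C,A)$ realized by $A\to B\xrightarrow{y}C$, its defect is $\widetilde{\delta}=\operatorname{Coker}(\mathcal{C}(-,y)\colon\mathcal{C}(-,B)\to\mathcal{C}(-,C))$ in $\mathsf{Mod}\,\mathcal{C}$. $\mathsf{def}\,\mathbb{E}$ is the subcategory of $\mathsf{Mod}\,\mathcal{C}$ of modules isomorphic to $\widetilde{\delta}$ for some $A,C\in\mathcal{C}$ and $\delta\in\mathbb{E}(C,A)$. For a closed subbifunctor $\mathbb{F}$ of $\mathbb{E}$, $\mathsf{def}\,\mathbb{F}$ is defined in the same way for $(\mathcal{C},\mathbb{F},\mathfrak{s}|_{\mathbb{F}})$,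 i.e. it consists of the modules isomorphic to $\widetilde{\delta}$ for some $\delta\in\mathbb{F}(C,A)$. The category $\mathsf{def}\,\mathbb{E}$ is a Serre subcategory of $\mathsf{coh}\,\mathcal{C}$, and is thereby regarded as an abelian category. A Serre subcategory of an abelian category is a subcategory closed under subobjects, quotients and extensions. *)

(* Defs.v *)
From HB Require Import structures.
From mathcomp Require Import all_boot all_algebra.

Set Implicit Arguments.
Unset Strict Implicit.
Unset Printing Implicit Defensive.

Import GRing.Theory.
Local Open Scope ring_scope.

Declare Scope cat_scope.
Delimit Scope cat_scope with cat.
Local Open Scope cat_scope.

Record additive_category := AdditiveCategory {
  Ob :> Type;
  Hom : Ob -> Ob -> zmodType;
  idm : forall A, Hom A A;
  comp : forall A B D, Hom B D -> Hom A B -> Hom A D;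
  comp_idl : forall A B (f : Hom A B), comp (idm B) f = f;
  comp_idr : forall A B (f : Hom A B), comp f (idm A) = f;
  compA : forall A B D X (h : Hom D X) (g : Hom B D) (f : Hom A B),
    comp h (comp g f) = comp (comp h g) f;
  compDl : forall A B D (g g' : Hom B D) (f : Hom A B),
    comp (g + g') f = comp g f + comp g' f;
  compDr : forall A B D (g : Hom B D) (f f' : Hom A B),
    comp g (f + f') = comp g f + comp g f';
  zero_ob : Ob;
  zero_obP : idm zero_ob = 0;
  biprod : Ob -> Ob -> Ob;
  in1 : forall A B, Hom A (biprod A B);
  in2 : forall A B, Hom B (biprod A B);
  pr1 : forall A B, Hom (biprod A B) A;
  pr2 : forall A B, Hom (biprod A B) B;
  pr1_in1 : forall A B, comp (pr1 A B) (in1 A B) = idm A;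
  pr2_in2 : forall A B, comp (pr2 A B) (in2 A B) = idm B;
  pr1_in2 : forall A B, comp (pr1 A B) (in2 A B) = 0;
  pr2_in1 : forall A B, comp (pr2 A B) (in1 A B) = 0;
  biprod_id : forall A B,
    comp (in1 A B) (pr1 A B) + comp (in2 A B) (pr2 A B) = idm (biprod A B)
}.

Arguments Hom {_} _ _.
Arguments idm {_} _.
Arguments comp {_ _ _ _} _ _.
Arguments in1 {_} _ _.
Arguments in2 {_} _ _.
Arguments pr1 {_} _ _.
Arguments pr2 {_} _ _.

Notation "g ∘ f" := (comp g f) (at level 40, left associativity) : cat_scope.
Notation "A ⊕ B" := (biprod A B) (at level 50, left associativity) : cat_scope.

Definition is_iso (C : additive_category) (A B : C) (f : Hom A B) : Prop :=
  exists g : Hom B A, g ∘ f = idm A /\ f ∘ g = idm B.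

Definition sum_mor (C : additive_category) (A A' B B' : C)
    (f : Hom A B) (f' : Hom A' B') : Hom (A ⊕ A') (B ⊕ B') :=
  in1 B B' ∘ f ∘ pr1 A A' + in2 B B' ∘ f' ∘ pr2 A A'.

(* "Small" means: in the universe of the carriers of abelian groups.  The index
   type [I] is put there explicitly; the universe of [Ob C] is independent of
   it, so that the condition is not satisfied by taking [I := Ob C]. *)
Definition skeletally_small (C : additive_category) : Prop :=
  exists (I : Type@{Algebra.Zmodule.axioms_.u0}) (X : I -> C),
    forall A : C, exists i (f : Hom (X i) A), is_iso f.

Record bifunctor (C : additive_category) := Bifunctor {
  ext :> C -> C -> zmodType;
  emap : forall X X' A A' : C,
    Hom X' X -> Hom A A' -> {additive ext X A -> ext X' A'};
  emap_id : forall X A (d : ext X A), emap (idm X) (idm A) d = d;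
  emap_comp : forall X X' X'' A A' A'' (c : Hom X' X) (c' : Hom X'' X')
      (a : Hom A A') (a' : Hom A' A'') (d : ext X A),
    emap (c ∘ c') (a' ∘ a) d = emap c' a' (emap c a d);
  emapDl : forall X X' A A' (c c' : Hom X' X) (a : Hom A A') (d : ext X A),
    emap (c + c') a d = emap c a d + emap c' a d;
  emapDr : forall X X' A A' (c : Hom X' X) (a a' : Hom A A') (d : ext X A),
    emap c (a + a') d = emap c a d + emap c a' d
}.

Section Realizations.

Variables (C : additive_category) (E : bifunctor C).

Definition push (X A A' : C) (a : Hom A A') (d : E X A) : E X A' :=
  emap E (idm X) a d.

Definition pull (X X' A : C) (c : Hom X' X) (d : E X A) : E X' A :=
  emap E c (idm A) d.

Definition ext_sum (X1 X2 A1 A2 : C) (d1 : E X1 A1) (d2 : E X2 A2) :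
    E (X1 ⊕ X2) (A1 ⊕ A2) :=
  emap E (pr1 X1 X2) (in1 A1 A2) d1 + emap E (pr2 X1 X2) (in2 A1 A2) d2.

(* [realizes s d x y]: the complex A --x--> B --y--> X belongs to the class
   assigned to [d]; that these complexes do form one equivalence class is
   [real_class] below. *)
Record realization_data := RealizationData {
  realizes :> forall X A : C, E X A ->
    forall B : C, Hom A B -> Hom B X -> Prop
}.

Arguments realizes _ {X A} d {B} x y.

Definition equiv_cpx (A X B B' : C) (x : Hom A B) (y : Hom B X)
    (x' : Hom A B') (y' : Hom B' X) : Prop :=
  exists b : Hom B B', [/\ is_iso b, b ∘ x = x' & y' ∘ b = y].

Variable s : realization_data.

Record additive_realization : Prop := AdditiveRealization {
  real_class : forall (X A : C) (d : E X A),
    exists (B : C) (x : Hom A B) (y : Hom B X), y ∘ x = 0 /\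
      forall (B' : C) (x' : Hom A B') (y' : Hom B' X),
        realizes s d x' y' <-> equiv_cpx x y x' y';
  real_mor : forall (X1 A1 X2 A2 : C) (d1 : E X1 A1) (d2 : E X2 A2)
      (a : Hom A1 A2) (c : Hom X1 X2),
    push a d1 = pull c d2 ->
    forall (B1 B2 : C) (x1 : Hom A1 B1) (y1 : Hom B1 X1)
      (x2 : Hom A2 B2) (y2 : Hom B2 X2),
    realizes s d1 x1 y1 -> realizes s d2 x2 y2 ->
    exists b : Hom B1 B2, b ∘ x1 = x2 ∘ a /\ y2 ∘ b = c ∘ y1;
  real_zero : forall A X : C, realizes s (0 : E X A) (in1 A X) (pr2 A X);
  real_sum : forall (X1 A1 X2 A2 : C) (d1 : E X1 A1) (d2 : E X2 A2)
      (B1 B2 : C) (x1 : Hom A1 B1) (y1 : Hom B1 X1)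
      (x2 : Hom A2 B2) (y2 : Hom B2 X2),
    realizes s d1 x1 y1 -> realizes s d2 x2 y2 ->
    realizes s (ext_sum d1 d2) (sum_mor x1 x2) (sum_mor y1 y2)
}.

Record extriangulated : Prop := Extriangulated {
  ext_real :> additive_realization;
  ET3 : forall (X1 A1 X2 A2 : C) (d1 : E X1 A1) (d2 : E X2 A2)
      (B1 B2 : C) (x1 : Hom A1 B1) (y1 : Hom B1 X1)
      (x2 : Hom A2 B2) (y2 : Hom B2 X2) (a : Hom A1 A2) (b : Hom B1 B2),
    realizes s d1 x1 y1 -> realizes s d2 x2 y2 -> b ∘ x1 = x2 ∘ a ->
    exists c : Hom X1 X2, c ∘ y1 = y2 ∘ b /\ push a d1 = pull c d2;
  ET3op : forall (X1 A1 X2 A2 : C) (d1 : E X1 A1) (d2 : E X2 A2)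
      (B1 B2 : C) (x1 : Hom A1 B1) (y1 : Hom B1 X1)
      (x2 : Hom A2 B2) (y2 : Hom B2 X2) (b : Hom B1 B2) (c : Hom X1 X2),
    realizes s d1 x1 y1 -> realizes s d2 x2 y2 -> c ∘ y1 = y2 ∘ b ->
    exists a : Hom A1 A2, b ∘ x1 = x2 ∘ a /\ push a d1 = pull c d2;
  ET4 : forall (A B D X F : C) (f : Hom A B) (f' : Hom B D) (d1 : E D A)
      (g : Hom B X) (g' : Hom X F) (d2 : E F B),
    realizes s d1 f f' -> realizes s d2 g g' ->
    exists (G : C) (h' : Hom X G) (d : Hom D G) (e : Hom G F) (d3 : E G A),
      [/\ h' ∘ g = d ∘ f', e ∘ h' = g' & realizes s d3 (g ∘ f) h'] /\
      [/\ realizes s (push f' d2) d e, pull d d3 = d1 & push f d3 = pull e d2];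
  ET4op : forall (A B D X F : C) (f' : Hom D A) (f : Hom A B) (d1 : E B D)
      (g' : Hom F B) (g : Hom B X) (d2 : E X F),
    realizes s d1 f' f -> realizes s d2 g' g ->
    exists (G : C) (d : Hom D G) (e : Hom G F) (h' : Hom G A) (d3 : E X G),
      [/\ h' ∘ d = f', f ∘ h' = g' ∘ e & realizes s d3 h' (g ∘ f)] /\
      [/\ realizes s (pull g' d1) d e, push e d3 = d2 & push d d1 = pull g d3]
}.

Definition sub_deflation (F : forall X A : C, E X A -> Prop) (B X : C)
    (y : Hom B X) : Prop :=
  exists (A : C) (d : E X A) (x : Hom A B), F X A d /\ realizes s d x y.

Record closed_subbifunctor := ClosedSubbifunctor {
  subext :> forall X A : C, E X A -> Prop;
  subext0 : forall X A, subext (0 : E X A);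
  subextB : forall X A (d d' : E X A),
    subext d -> subext d' -> subext (d - d');
  subext_push : forall X A A' (a : Hom A A') (d : E X A),
    subext d -> subext (push a d);
  subext_pull : forall X X' A (c : Hom X' X) (d : E X A),
    subext d -> subext (pull c d);
  subext_closed : forall B X Y (y : Hom B X) (z : Hom X Y),
    sub_deflation subext y -> sub_deflation subext z ->
    sub_deflation subext (z ∘ y)
}.

Definition subbifunctor_le (F G : closed_subbifunctor) : Prop :=
  forall (X A : C) (d : E X A), F X A d -> G X A d.

End Realizations.

Arguments realizes {C E} _ {X A} d {B} x y.

Record module (C : additive_category) := RightModule {
  mod_ob :> C -> zmodType;
  mod_map : forall A B : C, Hom A B -> {additive mod_ob B -> mod_ob A};
  mod_map_id : forall A (m : mod_ob A), mod_map (idm A) m = m;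
  mod_map_comp : forall A B D (g : Hom B D) (f : Hom A B) (m : mod_ob D),
    mod_map (g ∘ f) m = mod_map f (mod_map g m);
  mod_mapD : forall A B (f f' : Hom A B) (m : mod_ob B),
    mod_map (f + f') m = mod_map f m + mod_map f' m
}.

Record mod_hom (C : additive_category) (M N : module C) := ModHom {
  mod_app :> forall A : C, {additive M A -> N A};
  mod_nat : forall A B (f : Hom A B) (m : M B),
    mod_app A (mod_map M f m) = mod_map N f (mod_app B m)
}.

Section Representables.

Variable C : additive_category.

Definition precomp (A B X : C) (f : Hom A B) (g : Hom B X) : Hom A X := g ∘ f.
Definition postcomp (A X Y : C) (y : Hom X Y) (g : Hom A X) : Hom A Y := y ∘ g.

Lemma precomp_is_zmod_morphism (A B X : C) (f : Hom A B) :
  zmod_morphism (@precomp A B X f).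
Proof.
move=> g g'; apply: (addIr (precomp f g')).
by rewrite /precomp -compDl !subrK.
Qed.

Lemma postcomp_is_zmod_morphism (A X Y : C) (y : Hom X Y) :
  zmod_morphism (@postcomp A X Y y).
Proof.
move=> g g'; apply: (addIr (postcomp y g')).
by rewrite /postcomp -compDr !subrK.
Qed.

HB.instance Definition _ (A B X : C) (f : Hom A B) :=
  GRing.isZmodMorphism.Build (Hom B X) (Hom A X) (@precomp A B X f)
    (precomp_is_zmod_morphism f).

HB.instance Definition _ (A X Y : C) (y : Hom X Y) :=
  GRing.isZmodMorphism.Build (Hom A X) (Hom A Y) (@postcomp A X Y y)
    (postcomp_is_zmod_morphism y).

Definition yoneda (X : C) : module C :=
  @RightModule C (fun A => Hom A X) (fun A B f => @precomp A B X f)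
    (fun A m => comp_idr m)
    (fun A B D g f m => compA m g f)
    (fun A B f f' m => compDr m f f').

Definition yoneda_map (X Y : C) (y : Hom X Y) : mod_hom (yoneda X) (yoneda Y) :=
  @ModHom C (yoneda X) (yoneda Y) (fun A => @postcomp A X Y y)
    (fun A B f m => compA y m f).

End Representables.

(* In this section the test objects range over the full subcategory of Mod C on
   the modules satisfying [P]: the notions are those intrinsic to [P]. *)

Section FullSubcategory.

Variables (C : additive_category) (P : module C -> Prop).

Definition is_mono (L M : module C) (f : mod_hom L M) : Prop :=
  forall (K : module C) (u v : mod_hom K L), P K ->
    (forall A k, f A (u A k) = f A (v A k)) -> forall A k, u A k = v A k.

Definition is_epi (M N : module C) (g : mod_hom M N) : Prop :=
  forall (Q : module C) (u v : mod_hom N Q), P Q ->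
    (forall A m, u A (g A m) = v A (g A m)) -> forall A n, u A n = v A n.

Definition is_kernel (L M N : module C) (f : mod_hom L M) (g : mod_hom M N) :
    Prop :=
  (forall A l, g A (f A l) = 0) /\
  forall (K : module C) (h : mod_hom K M), P K ->
    (forall A k, g A (h A k) = 0) ->
    exists u : mod_hom K L, (forall A k, f A (u A k) = h A k) /\
      forall u' : mod_hom K L, (forall A k, f A (u' A k) = h A k) ->
        forall A k, u' A k = u A k.

Definition is_cokernel (L M N : module C) (f : mod_hom L M) (g : mod_hom M N) :
    Prop :=
  (forall A l, g A (f A l) = 0) /\
  forall (Q : module C) (h : mod_hom M Q), P Q ->
    (forall A l, h A (f A l) = 0) ->
    exists u : mod_hom N Q, (forall A m, u A (g A m) = h A m) /\
      forall u' : mod_hom N Q, (forall A m, u' A (g A m) = h A m) ->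
        forall A n, u' A n = u A n.

(* Closure under binary direct sums is the case of split extensions. *)
Record serre_subcategory := SerreSubcategory {
  serre :> module C -> Prop;
  serre_in : forall M, serre M -> P M;
  serre_iso : forall (M N : module C) (f : mod_hom M N) (g : mod_hom N M),
    (forall A m, g A (f A m) = m) -> (forall A n, f A (g A n) = n) ->
    serre M -> serre N;
  serre_zero : forall Z : module C, (forall A (z : Z A), z = 0) -> serre Z;
  serre_sub : forall (L M : module C) (f : mod_hom L M),
    P L -> is_mono f -> serre M -> serre L;
  serre_quot : forall (M N : module C) (g : mod_hom M N),
    P N -> is_epi g -> serre M -> serre N;
  serre_ext : forall (L M N : module C) (f : mod_hom L M) (g : mod_hom M N),
    P M -> is_kernel f g -> is_cokernel f g -> serre L -> serre N -> serre M
}.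

Definition serre_le (S T : serre_subcategory) : Prop :=
  forall M : module C, S M -> T M.

End FullSubcategory.

(* [M] is a cokernel of C(-,y) in Mod C; cokernels being unique up to a unique
   isomorphism, these are the modules isomorphic to the defect of [d], for
   some [d] in [F]. *)
Definition defects (C : additive_category) (E : bifunctor C)
    (s : realization_data E) (F : forall X A : C, E X A -> Prop)
    (M : module C) : Prop :=
  exists (A B X : C) (d : E X A) (x : Hom A B) (y : Hom B X)
      (p : mod_hom (yoneda X) M),
    [/\ F X A d, realizes s d x y &
        is_cokernel (fun _ => True) (yoneda_map y) p].

Definition all_defects (C : additive_category) (E : bifunctor C)
    (s : realization_data E) : module C -> Prop :=
  defects s (fun X A _ => True).

Definition poset_isomorphism (P Q : Type) (leP : P -> P -> Prop)
    (leQ : Q -> Q -> Prop) (f : P -> Q) : Prop :=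
  bijective f /\ forall x y, leP x y <-> leQ (f x) (f y).

(* Main.v *)
From HB Require Import structures.
From mathcomp Require Import all_boot all_algebra boolp.
Require Import Defs.

Set Implicit Arguments.
Unset Strict Implicit.
Unset Printing Implicit Defensive.

Import GRing.Theory.
Local Open Scope ring_scope.
Local Open Scope cat_scope.

(** The defect of [d] in E(X, A), realized by A -> B -> X, is the image of the
    map C(-, X) -> E(-, A), g |-> g^*d: a cyclic module whose generator has as
    annihilator the maps killing [d].  Two generators of one module give
    extensions obtained from each other by pullbacks and pushouts, so a
    subbifunctor is determined by its defects.  Kernels and cokernels of maps of
    defects are again defects, so that monomorphisms and epimorphisms of defects
    are the injective and surjective maps.  Finally, closure of F under
    composition of deflations corresponds to closure of the defects under
    extensions: if q is a deflation of v in F with q^*e in F, then composing q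
    with a deflation of q^*e shows that e is in F; conversely (ET4)^op exhibits
    the defect of a composite as an extension of the defect of one factor by a
    quotient of the defect of the other. *)

(** * Pullback and pushout of extensions *)

Section Bifunctor.

Variables (C : additive_category) (E : bifunctor C).

Lemma pull_id (X A : C) (d : E X A) : pull (idm X) d = d.
Proof. exact: emap_id. Qed.

Lemma push_id (X A : C) (d : E X A) : push (idm A) d = d.
Proof. exact: emap_id. Qed.

Lemma pull_comp (X X' X'' A : C) (c : Hom X' X) (c' : Hom X'' X') (d : E X A) :
  pull (c ∘ c') d = pull c' (pull c d).
Proof. by rewrite /pull -{1}[idm A](comp_idl (idm A)) emap_comp. Qed.

Lemma push_comp (X A A' A'' : C) (a : Hom A A') (a' : Hom A' A'') (d : E X A) :
  push (a' ∘ a) d = push a' (push a d).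
Proof. by rewrite /push -{1}[idm X](comp_idl (idm X)) emap_comp. Qed.

Lemma pull_push (X X' A A' : C) (c : Hom X' X) (a : Hom A A') (d : E X A) :
  pull c (push a d) = push a (pull c d).
Proof. by rewrite /pull /push -!emap_comp !comp_idl !comp_idr. Qed.

Lemma pull0 (X X' A : C) (c : Hom X' X) : pull c (0 : E X A) = 0.
Proof. exact: raddf0. Qed.

Lemma push0 (X A A' : C) (a : Hom A A') : push a (0 : E X A) = 0.
Proof. exact: raddf0. Qed.

Lemma pullD (X X' A : C) (c : Hom X' X) (d d' : E X A) :
  pull c (d + d') = pull c d + pull c d'.
Proof. exact: raddfD. Qed.

Lemma pushD (X A A' : C) (a : Hom A A') (d d' : E X A) :
  push a (d + d') = push a d + push a d'.
Proof. exact: raddfD. Qed.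

Lemma pullDl (X X' A : C) (c c' : Hom X' X) (d : E X A) :
  pull (c + c') d = pull c d + pull c' d.
Proof. exact: emapDl. Qed.

Lemma pushDl (X A A' : C) (a a' : Hom A A') (d : E X A) :
  push (a + a') d = push a d + push a' d.
Proof. exact: emapDr. Qed.

Lemma pull0l (X X' A : C) (d : E X A) : pull (0 : Hom X' X) d = 0.
Proof. by apply: (addrI (pull (0 : Hom X' X) d)); rewrite -pullDl !addr0. Qed.

Lemma push0l (X A A' : C) (d : E X A) : push (0 : Hom A A') d = 0.
Proof. by apply: (addrI (push (0 : Hom A A') d)); rewrite -pushDl !addr0. Qed.

Lemma pullBl (X X' A : C) (c c' : Hom X' X) (d : E X A) :
  pull (c - c') d = pull c d - pull c' d.
Proof. by apply: (addIr (pull c' d)); rewrite -pullDl !subrK. Qed.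

Lemma pushNl (X A A' : C) (a : Hom A A') (d : E X A) :
  push (- a) d = - push a d.
Proof. by apply: (addIr (push a d)); rewrite -pushDl !addNr push0l. Qed.

End Bifunctor.

(** * Exact sequences attached to a realized extension *)

Section LongExactSequences.

Variables (C : additive_category) (E : bifunctor C) (s : realization_data E).
Hypothesis hs : extriangulated s.

Lemma realization_exists (X A : C) (d : E X A) :
  exists (B : C) (x : Hom A B) (y : Hom B X), realizes s d x y.
Proof.
have [B [x [y [_ H]]]] := real_class hs d.
exists B, x, y; apply/H; exists (idm B); split.
- by exists (idm B); rewrite comp_idl.
- exact: comp_idl.
- exact: comp_idr.
Qed.

(** The maps [pr2] and [y] form a commuting square from the split sequence ending in [B] to the
    realization of [d]; (ET3)^op completes it, so [pull y d] is a pushout of 0. *)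
Lemma pull_deflation (X A B : C) (d : E X A) (x : Hom A B) (y : Hom B X) :
  realizes s d x y -> pull y d = 0.
Proof.
move=> hd; have h0 := real_zero hs (zero_ob C) B.
have [a [_ <-]] := ET3op hs h0 hd (erefl (y ∘ pr2 (zero_ob C) B)).
exact: push0.
Qed.

(** Exactness of C(W, B) -> C(W, X) -> E(W, A). If [pull g d] vanishes, (id, g) is a morphism from
    the split extension to [d], and its map of middle terms, restricted to [W], lifts [g]. *)
Lemma pull_eq0 (X A B : C) (d : E X A) (x : Hom A B) (y : Hom B X) :
  realizes s d x y ->
  forall (W : C) (g : Hom W X), pull g d = 0 <-> exists h, g = y ∘ h.
Proof.
move=> hd W g; split=> [g0 | [h ->]]; last first.
  by rewrite pull_comp (pull_deflation hd) pull0.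
have h0 := real_zero hs A W.
have [|b [_ hb]] := real_mor hs (d1 := 0) (d2 := d) (a := idm A) (c := g) _ h0 hd.
  by rewrite g0 push0.
by exists (b ∘ in2 A W); rewrite compA hb -compA pr2_in2 comp_idr.
Qed.

Lemma push_inflation (X A B : C) (d : E X A) (x : Hom A B) (y : Hom B X) :
  realizes s d x y -> push x d = 0.
Proof.
move=> hd; have h0 := real_zero hs B (zero_ob C).
have [c [_ ->]] := ET3 hs hd h0 (erefl (in1 B (zero_ob C) ∘ x)).
exact: pull0.
Qed.

(** Exactness of C(W, X) -> E(W, A) -> E(W, B). *)
Lemma push_inflation_eq0 (X A B W : C) (d : E X A) (x : Hom A B) (y : Hom B X)
    (e : E W A) :
  realizes s d x y -> push x e = 0 <-> exists h, e = pull h d.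
Proof.
move=> hd; split=> [e0 | [h ->]]; last first.
  by rewrite -pull_push (push_inflation hd) pull0.
have [K [u [v he]]] := realization_exists e.
have h0 := real_zero hs B W.
(* As [push x e] is 0, (x, id) is a morphism from [e] to the split extension. The first component of
   [b] extends [x] along [u], and (ET3) then supplies [h]. *)
have [|b [hb _]] := real_mor hs (d1 := e) (d2 := 0) (a := x) (c := idm W) _ he h0.
  by rewrite e0 pull0.
have [|h [_ hh]] := ET3 hs (a := idm A) (b := pr1 B W ∘ b) he hd.
  by rewrite -compA hb compA pr1_in1 comp_idl comp_idr.
by exists h; rewrite -hh push_id.
Qed.

(** Exactness of C(A, W) -> E(X, W) -> E(B, W): [y] lifts to the middle term of [e], and (ET3)^op
    turns the lift into [a]. *)
Lemma pull_deflation_eq0 (X A B W : C) (d : E X A) (x : Hom A B) (y : Hom B X)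
    (e : E X W) :
  realizes s d x y -> pull y e = 0 -> exists a, e = push a d.
Proof.
move=> hd e0; have [K [u [v he]]] := realization_exists e.
have [b hb] := (pull_eq0 he y).1 e0.
have [|a [_ ha]] := ET3op hs (b := b) (c := idm X) hd he.
  by rewrite comp_idl.
by exists a; rewrite ha pull_id.
Qed.

End LongExactSequences.

(** * Module homomorphisms, pointwise kernels and cokernels *)

Section Modules.

Variable C : additive_category.

Lemma mod_mapB (M : module C) (A B : C) (f f' : Hom A B) (m : M B) :
  mod_map M (f - f') m = mod_map M f m - mod_map M f' m.
Proof. by apply: (addIr (mod_map M f' m)); rewrite -mod_mapD !subrK. Qed.

Lemma mod_hom_of_fun (M N : module C) (f : forall A : C, M A -> N A) :
  (forall A, zmod_morphism (f A)) ->
  (forall A B (h : Hom A B) m, f A (mod_map M h m) = mod_map N h (f B m)) ->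
  exists u : mod_hom M N, forall A m, u A m = f A m.
Proof.
move=> fB fnat.
pose F A : {additive M A -> N A} :=
  HB.pack (f A) (GRing.isZmodMorphism.Build _ _ (f A) (fB A)).
by exists (@ModHom C M N F fnat).
Qed.

(** Serves for maps defined by choosing preimages: single-valuedness of [R] makes the chosen values
    additive and natural. *)
Lemma mod_hom_of_rel (M N : module C) (R : forall A : C, M A -> N A -> Prop) :
  (forall A m, exists n, R A m n) ->
  (forall A m n n', R A m n -> R A m n' -> n = n') ->
  (forall A m m' n n', R A m n -> R A m' n' -> R A (m - m') (n - n')) ->
  (forall A B (h : Hom A B) m n,
     R B m n -> R A (mod_map M h m) (mod_map N h n)) ->
  exists u : mod_hom M N, forall A m, R A m (u A m).
Proof.
move=> Rtot Rfun Rsub Rnat.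
pose f A m := projT1 (cid (Rtot A m)).
have fP A m : R A m (f A m) by rewrite /f; case: cid.
have [||u hu] := @mod_hom_of_fun M N f.
- by move=> A m m'; apply: Rfun (fP _ _) _; apply: Rsub.
- by move=> A B h m; apply: Rfun (fP _ _) _; apply: Rnat.
by exists u => A m; rewrite hu.
Qed.

Lemma mod_hom_id (M : module C) :
  exists u : mod_hom M M, forall A m, u A m = m.
Proof. exact: mod_hom_of_fun. Qed.

Lemma mod_hom_zero (M N : module C) :
  exists u : mod_hom M N, forall A m, u A m = 0.
Proof.
apply: (mod_hom_of_fun (f := fun A _ => 0)) => [A m m' | A B h m].
  by rewrite subr0.
by rewrite raddf0.
Qed.

Lemma mod_hom_comp (L M N : module C) (g : mod_hom M N) (f : mod_hom L M) :
  exists u : mod_hom L N, forall A l, u A l = g A (f A l).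
Proof.
apply: (mod_hom_of_fun (f := fun A l => g A (f A l))) => [A l l' | A B h l].
  by rewrite !raddfB.
by rewrite !mod_nat.
Qed.

Lemma mod_hom_yoneda (M : module C) (X : C) (m : M X) :
  exists u : mod_hom (yoneda X) M, forall A g, u A g = mod_map M g m.
Proof.
apply: (mod_hom_of_fun (M := yoneda X) (f := fun A g => mod_map M g m)).
  by move=> A g g'; rewrite mod_mapB.
by move=> A B h g; rewrite -mod_map_comp.
Qed.

Lemma yoneda_homE (M : module C) (X : C) (p : mod_hom (yoneda X) M) (A : C)
    (g : Hom A X) :
  mod_map M g (p X (idm X)) = p A g.
Proof. by rewrite -mod_nat /= /precomp comp_idl. Qed.

Section ShortExact.

Variables (L M N : module C) (f : mod_hom L M) (g : mod_hom M N).

Lemma injective_mono (P : module C -> Prop) :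
  (forall A l, f A l = 0 -> l = 0) -> is_mono P f.
Proof.
move=> finj K u v _ uv A k; apply/eqP; rewrite -subr_eq0; apply/eqP/finj.
by rewrite raddfB uv subrr.
Qed.

Lemma surjective_epi (P : module C -> Prop) :
  (forall A n, exists m, n = g A m) -> is_epi P g.
Proof. by move=> gsurj Q u v _ uv A n; have [m ->] := gsurj A n. Qed.

Lemma kernel_mono (P : module C -> Prop) : is_kernel P f g -> is_mono P f.
Proof.
move=> [gf0 funiv] K u v PK uv A k.
have [h hE] := mod_hom_comp f v.
have [|w [_ wuniq]] := funiv K h PK.
  by move=> B b; rewrite hE gf0.
by rewrite (wuniq u) ?(wuniq v) // => B b; rewrite hE ?uv.
Qed.

Lemma cokernel_epi (P : module C -> Prop) : is_cokernel P f g -> is_epi P g.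
Proof.
move=> [gf0 guniv] Q u v PQ uv A n.
have [h hE] := mod_hom_comp v g.
have [|w [_ wuniq]] := guniv Q h PQ.
  by move=> B b; rewrite hE gf0 raddf0.
by rewrite (wuniq u) ?(wuniq v) // => B b; rewrite hE ?uv.
Qed.

Hypothesis gf0 : forall A l, g A (f A l) = 0.
Hypothesis exact_f_g : forall A m, g A m = 0 -> exists l, f A l = m.

(** The factorization sends [k] to the unique preimage of [h A k] under [f]. It exists for every
    test module, hence for any [P]. *)
Lemma exact_kernel (P : module C -> Prop) :
  (forall A l, f A l = 0 -> l = 0) -> is_kernel P f g.
Proof.
move=> finj0; split=> // K h _ gh0.
have finj A l l' : f A l = f A l' -> l = l'.
  move=> ll'; apply/eqP; rewrite -subr_eq0; apply/eqP/finj0.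
  by rewrite raddfB ll' subrr.
have [|||| u hu] := @mod_hom_of_rel K L (fun A k l => f A l = h A k).
- by move=> A k; apply: exact_f_g.
- by move=> A k l l' <- /finj.
- by move=> A k k' l l' hl hl'; rewrite !raddfB hl hl'.
- by move=> A B c k l hl; rewrite !mod_nat hl.
by exists u; split=> // u' hu' A k; apply: finj; rewrite hu hu'.
Qed.

(** The factorization sends [n] to [h A m] for any preimage [m]; the choice is immaterial because
    [h] vanishes on the kernel of [g]. *)
Lemma exact_cokernel (P : module C -> Prop) :
  (forall A n, exists m, n = g A m) -> is_cokernel P f g.
Proof.
move=> gsurj; split=> // Q h _ hf0.
have hg0 A m : g A m = 0 -> h A m = 0.
  by move=> /exact_f_g [l <-]; apply: hf0.
have [|||| u hu] :=
    @mod_hom_of_rel N Q (fun A n q => exists m, n = g A m /\ q = h A m).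
- by move=> A n; have [m ->] := gsurj A n; exists (h A m), m.
- move=> A n q q' [m [-> ->]] [m' [mm' ->]].
  by apply/eqP; rewrite -subr_eq0 -raddfB hg0 // raddfB mm' subrr.
- move=> A n n' q q' [m [-> ->]] [m' [-> ->]].
  by exists (m - m'); rewrite !raddfB.
- move=> A B c n q [m [-> ->]].
  by exists (mod_map M c m); rewrite !mod_nat.
have ug A m : u A (g A m) = h A m.
  have [m' [mm' ->]] := hu A (g A m).
  by apply/eqP; rewrite -subr_eq0 -raddfB hg0 // raddfB mm' subrr.
by exists u; split=> // u' hu' A n; have [m ->] := gsurj A n; rewrite ug hu'.
Qed.

End ShortExact.

End Modules.

(** * The cyclic submodule of E(-, A) generated by an extension *)

Section CyclicSubmodule.

Variables (C : additive_category) (E : bifunctor C) (X A : C) (d : E X A).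

(** Made boolean by classical logic, so that the subgroup structure is inherited through a
    subtype. *)
Definition in_cyclic (W : C) : pred (E W A) :=
  fun e => `[< exists g : Hom W X, e = pull g d >].

Lemma in_cyclic_zmod_closed (W : C) : zmod_closed (@in_cyclic W).
Proof.
split=> [|e e' /asboolP [g ->] /asboolP [g' ->]]; apply/asboolP.
  by exists 0; rewrite pull0l.
by exists (g - g'); rewrite pullBl.
Qed.

HB.instance Definition _ (W : C) :=
  GRing.isZmodClosed.Build (E W A) (@in_cyclic W) (in_cyclic_zmod_closed W).

Record cyclic (W : C) := Cyclic {
  cyclic_val :> E W A;
  _ : cyclic_val \in @in_cyclic W
}.

HB.instance Definition _ (W : C) := [isSub for @cyclic_val W].
HB.instance Definition _ (W : C) := [Choice of cyclic W by <:].
HB.instance Definition _ (W : C) :=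
  [SubChoice_isSubZmodule of cyclic W by <:].

Lemma cyclic_pull_subproof (W V : C) (f : Hom W V) (e : cyclic V) :
  pull f (cyclic_val e) \in @in_cyclic W.
Proof.
case: e => e he /=; have /asboolP [g ->] := he; apply/asboolP.
by exists (g ∘ f); rewrite pull_comp.
Qed.

Definition cyclic_pull (W V : C) (f : Hom W V) (e : cyclic V) : cyclic W :=
  Cyclic (cyclic_pull_subproof f e).

Lemma cyclic_pull_is_zmod_morphism (W V : C) (f : Hom W V) :
  zmod_morphism (cyclic_pull f).
Proof. by move=> e e'; apply: val_inj; rewrite !raddfB /= /pull raddfB. Qed.

HB.instance Definition _ (W V : C) (f : Hom W V) :=
  GRing.isZmodMorphism.Build (cyclic V) (cyclic W) (cyclic_pull f)
    (cyclic_pull_is_zmod_morphism f).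

Lemma cyclic_pull_id (W : C) (e : cyclic W) : cyclic_pull (idm W) e = e.
Proof. by apply: val_inj; rewrite /= pull_id. Qed.

Lemma cyclic_pull_comp (W V U : C) (g : Hom V U) (f : Hom W V) (e : cyclic U) :
  cyclic_pull (g ∘ f) e = cyclic_pull f (cyclic_pull g e).
Proof. by apply: val_inj; rewrite /= pull_comp. Qed.

Lemma cyclic_pullD (W V : C) (f f' : Hom W V) (e : cyclic V) :
  cyclic_pull (f + f') e = cyclic_pull f e + cyclic_pull f' e.
Proof. by apply: val_inj; rewrite raddfD /= pullDl. Qed.

Definition cyclic_module : module C :=
  @RightModule C (fun W => cyclic W) (fun W V f => @cyclic_pull W V f)
    cyclic_pull_id cyclic_pull_comp cyclic_pullD.

End CyclicSubmodule.

(** * Modules presented by an extension *)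

Section Presentations.

Variables (C : additive_category) (E : bifunctor C).

(* Since [pull g d = 0] exactly when [g] factors through a deflation realizing
   [d], this says that [m] identifies the defect of [d] with [M]. *)
Definition presents (X A : C) (d : E X A) (M : module C) (m : M X) : Prop :=
  (forall W (w : M W), exists g : Hom W X, w = mod_map M g m) /\
  (forall W (g : Hom W X), mod_map M g m = 0 <-> pull g d = 0).

Lemma presents_exists (X A : C) (d : E X A) :
  exists (M : module C) (m : M X), presents d m.
Proof.
have hd : d \in @in_cyclic C E X A d X.
  by apply/asboolP; exists (idm X); rewrite pull_id.
exists (cyclic_module d), (Cyclic hd); split=> W.
  move=> [w hw]; have /asboolP [g wE] := hw; exists g.
  by apply: val_inj.
by move=> g; split=> [/(congr1 val) | g0]; last apply: val_inj;
  rewrite raddf0.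
Qed.

Lemma presents_eq (X A : C) (d : E X A) (M : module C) (m : M X) :
  presents d m -> forall (W : C) (g g' : Hom W X),
  mod_map M g m = mod_map M g' m <-> pull g d = pull g' d.
Proof.
move=> [_ mann] W g g'; have := mann W (g - g').
rewrite mod_mapB pullBl => H.
by split=> /eqP; rewrite -subr_eq0 => /eqP /H /eqP; rewrite subr_eq0 => /eqP.
Qed.

(** Universal property of a cyclic module: the generator may go to any element killed by its
    annihilator. *)
Lemma hom_of_presents (X A : C) (d : E X A) (M : module C) (m : M X)
    (N : module C) (n : N X) :
  presents d m ->
  (forall W (g : Hom W X), pull g d = 0 -> mod_map N g n = 0) ->
  exists u : mod_hom M N,
    forall W (g : Hom W X), u W (mod_map M g m) = mod_map N g n.
Proof.
move=> hm hn; have [mgen _] := hm.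
have hgg W (g g' : Hom W X) :
    mod_map M g m = mod_map M g' m -> mod_map N g n = mod_map N g' n.
  move=> /(presents_eq hm) gg'; apply/eqP.
  by rewrite -subr_eq0 -mod_mapB hn // pullBl gg' subrr.
have [|||| u hu] := @mod_hom_of_rel C M N
    (fun W w v => exists g, w = mod_map M g m /\ v = mod_map N g n).
- by move=> W w; have [g ->] := mgen W w; exists (mod_map N g n), g.
- by move=> W w v v' [g [-> ->]] [g' [/hgg -> ->]].
- move=> W w w' v v' [g [-> ->]] [g' [-> ->]].
  by exists (g - g'); rewrite !mod_mapB.
- move=> W V h w v [g [-> ->]].
  by exists (g ∘ h); rewrite !mod_map_comp.
exists u => W g; have [g' [gg' ->]] := hu W (mod_map M g m).
exact: hgg.
Qed.

Lemma presents_iso (X A : C) (d : E X A) (M N : module C) (m : M X) (n : N X) :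
  presents d m -> presents d n ->
  exists (f : mod_hom M N) (g : mod_hom N M),
    (forall W w, g W (f W w) = w) /\ (forall W w, f W (g W w) = w).
Proof.
move=> hm hn.
have [f hf] := hom_of_presents (n := n) hm (fun W g => (hn.2 W g).2).
have [g hg] := hom_of_presents (n := m) hn (fun W g => (hm.2 W g).2).
exists f, g; split=> W w.
  by have [h ->] := hm.1 W w; rewrite hf hg.
by have [h ->] := hn.1 W w; rewrite hg hf.
Qed.

Lemma presents_pull (X A X' : C) (d : E X A) (c : Hom X' X) (L M : module C)
    (m : M X) (l : L X') (f : mod_hom L M) :
  presents d m -> (forall W w, exists g : Hom W X', w = mod_map L g l) ->
  (forall W w, f W w = 0 -> w = 0) -> f X' l = mod_map M c m ->
  presents (pull c d) l.
Proof.
move=> hm lgen finj fl; split=> // W g.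
rewrite -pull_comp -(hm.2 W) mod_map_comp -fl -mod_nat.
by split=> [-> | /finj //]; rewrite raddf0.
Qed.

Lemma presents_image (X A Y B : C) (d : E X A) (e : E Y B) (M N : module C)
    (m : M X) (n : N Y) (g : mod_hom M N) :
  presents d m -> presents e n -> (forall W w, exists v, w = g W v) ->
  exists c, presents (pull c e) (g X m).
Proof.
move=> hm hn gsurj; have [c gm] := hn.1 X (g X m); exists c.
split=> [W w | W h].
  have [v ->] := gsurj W w; have [h ->] := hm.1 W v.
  by exists h; rewrite mod_nat.
by rewrite gm -mod_map_comp -pull_comp; apply: hn.2.
Qed.

Variable s : realization_data E.
Hypothesis hs : extriangulated s.

(** A deflation of [d'] kills [d'], hence [d]; exactness at E(X, A) concludes. *)
Lemma annihilator_le (X A A' : C) (d : E X A) (d' : E X A') :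
  (forall W (g : Hom W X), pull g d' = 0 -> pull g d = 0) ->
  exists a, d = push a d'.
Proof.
move=> le; have [B [x [y hd]]] := realization_exists hs d'.
by apply: (pull_deflation_eq0 hs hd); apply/le/(pull_deflation hs hd).
Qed.

Lemma presents_change (X A X' A' : C) (d : E X A) (d' : E X' A')
    (M : module C) (m : M X) (m' : M X') :
  presents d m -> presents d' m' -> exists c a, d = push a (pull c d').
Proof.
move=> hm hm'; have [c mE] := hm'.1 X m; have [c' m'E] := hm.1 X' m'.
(* Every map killing [d'] kills [m'], hence also [pull c' d], which is thus a pushout of [d'].
   Pulling back along [c] recovers [d], since [c' ∘ c] fixes [m]. *)
have [|a ha] := @annihilator_le _ _ _ (pull c' d) d'.
  move=> W g /(hm'.2 W g); rewrite m'E -mod_map_comp -pull_comp.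
  exact: (hm.2 W (c' ∘ g)).1.
exists c, a; rewrite -pull_push -ha -pull_comp -{1}[d]pull_id.
by apply/(presents_eq hm); rewrite mod_map_comp -m'E -mE mod_map_id.
Qed.

Lemma defectsP (F : forall X A : C, E X A -> Prop) (M : module C) :
  defects s F M <->
  exists (X A : C) (d : E X A) (m : M X), F X A d /\ presents d m.
Proof.
split.
  move=> [A [B [X [d [x [y [p [Fd hd [py0 puniv]]]]]]]]].
  exists X, A, d, (p X (idm X)); split=> //.
  (* The abstract cokernel [M] is compared with a concrete module [D] presented by [d], through [u]
     from [M] to [D] and [v] back. *)
  have [D [e he]] := presents_exists d.
  have [pD pDE] := mod_hom_yoneda e.
  have [|u [up _]] := puniv D pD I.
    move=> W l; rewrite pDE; apply/(he.2 W)/(pull_eq0 hs hd).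
    by exists l.
  have [|v vE] := hom_of_presents (n := p X (idm X)) he.
    move=> W g /(pull_eq0 hs hd) [h ->].
    by rewrite yoneda_homE; apply: py0.
  have [id idE] := mod_hom_id M; have [vu vuE] := mod_hom_comp v u.
  (* Uniqueness of the factorization of [p] through itself forces [v] after [u] to be the identity,
     so [u] is injective. *)
  have [w [_ wuniq]] := puniv M p I py0.
  have vuK W n : v W (u W n) = n.
    rewrite -vuE -[RHS]idE (wuniq vu) ?(wuniq id) // => V g; rewrite ?idE //.
    by rewrite vuE up pDE vE yoneda_homE.
  split=> W.
    move=> n; have [g ug] := he.1 W (u W n); exists g.
    by rewrite -[LHS]vuK ug vE.
  move=> g; rewrite yoneda_homE -(he.2 W g) -pDE -up.
  by split=> [-> | u0]; rewrite ?raddf0 // -[LHS]vuK u0 raddf0.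
move=> [X [A [d [m [Fd hm]]]]].
have [B [x [y hd]]] := realization_exists hs d.
have [p pE] := mod_hom_yoneda m.
exists A, B, X, d, x, y, p; split=> //; apply: exact_cokernel => W.
- by move=> l; rewrite pE; apply/(hm.2 W)/(pull_eq0 hs hd); exists l.
- by move=> g; rewrite pE => /(hm.2 W) /(pull_eq0 hs hd) [h ->]; exists h.
- by move=> w; have [g ->] := hm.1 W w; exists g; rewrite pE.
Qed.

Lemma presents_all_defects (X A : C) (d : E X A) (M : module C) (m : M X) :
  presents d m -> all_defects s M.
Proof. by move=> hm; apply/defectsP; exists X, A, d, m. Qed.

(* The kernel of the map of defects induced by [c] is generated by the class of
   a deflation realizing [pull c e]. *)
Lemma kernel_presented (X A Y B P : C) (d : E X A) (e : E Y B) (c : Hom X Y)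
    (M N : module C) (m : M X) (n : N Y) (f : mod_hom M N)
    (x : Hom B P) (q : Hom P X) :
  presents d m -> presents e n -> f X m = mod_map N c n ->
  realizes s (pull c e) x q ->
  exists (K : module C) (k : K P) (u : mod_hom K M),
    [/\ presents (pull q d) k, (forall W w, u W w = 0 -> w = 0),
        (forall W w, f W (u W w) = 0) &
        (forall W z, f W z = 0 -> exists w, u W w = z)].
Proof.
move=> hm hn fm hq; have [K [k hk]] := presents_exists (pull q d).
have [|u uE] := hom_of_presents (n := mod_map M q m) hk.
  by move=> W g g0; rewrite -mod_map_comp; apply/(hm.2 W); rewrite pull_comp.
exists K, k, u; split=> // W w.
- have [g ->] := hk.1 W w; rewrite uE -mod_map_comp => /(hm.2 W).
  by rewrite pull_comp => g0; apply/(hk.2 W).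
- have [g ->] := hk.1 W w; rewrite uE !mod_nat fm -!mod_map_comp.
  apply/(hn.2 W); rewrite pull_comp; apply/(pull_eq0 hs hq).
  by exists g.
- have [g ->] := hm.1 W w; rewrite mod_nat fm -mod_map_comp => /(hn.2 W).
  rewrite pull_comp => /(pull_eq0 hs hq) [h ->].
  by exists (mod_map K h k); rewrite uE mod_map_comp.
Qed.

(** The kernel is itself a defect, hence an admissible test object: its inclusion and the zero map
    agree after [f]. *)
Lemma mono_injective (L M : module C) (f : mod_hom L M) :
  all_defects s L -> all_defects s M -> is_mono (all_defects s) f ->
  forall W l, f W l = 0 -> l = 0.
Proof.
move=> /defectsP [X [A [d [l [_ hl]]]]] /defectsP [Y [B [e [m [_ hm]]]]] fmono.
have [c fl] := hm.1 X (f X l).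
have [P [x [q hq]]] := realization_exists hs (pull c e).
have [K [k [u [hk _ fu0 ker]]]] := kernel_presented hl hm fl hq.
have [z zE] := mod_hom_zero K L.
move=> W w /ker [v <-]; rewrite -(zE W v).
apply: fmono => [|V v']; first exact: presents_all_defects hk.
by rewrite fu0 zE raddf0.
Qed.

(* The cokernel of the map of defects induced by [c] is the defect of
   [push x e], where [x] is an inflation realizing [pull c e]. *)
Lemma epi_surjective (M N : module C) (g : mod_hom M N) :
  all_defects s M -> all_defects s N -> is_epi (all_defects s) g ->
  forall W n, exists m, n = g W m.
Proof.
move=> /defectsP [X [A [d [m [_ hm]]]]] /defectsP [Y [B [e [n [_ hn]]]]] gepi.
have [c gm] := hn.1 X (g X m).
have [P [x [q hq]]] := realization_exists hs (pull c e).
have [Q [r hr]] := presents_exists (push x e).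
have [|t tE] := hom_of_presents (n := r) hn.
  by move=> W h h0; apply/(hr.2 W); rewrite pull_push h0 push0.
have [z zE] := mod_hom_zero N Q.
have t0 : forall W w, t W w = 0.
  move=> W w; rewrite -(zE W w); apply: gepi => [|V v].
    exact: presents_all_defects hr.
  have [h ->] := hm.1 V v; rewrite zE mod_nat gm -mod_map_comp tE.
  by apply/(hr.2 V); rewrite pull_comp (pull_push c) (push_inflation hs hq) pull0.
move=> W w; have [h ->] := hn.1 W w.
have /(hr.2 W) : mod_map Q h r = 0 by rewrite -tE t0.
rewrite pull_push => /(push_inflation_eq0 hs _ hq) [h' hh'].
exists (mod_map M h' m); rewrite mod_nat gm -mod_map_comp.
by apply/(presents_eq hn); rewrite pull_comp.
Qed.

End Presentations.

(** * From closed subbifunctors to Serre subcategories *)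

Section ClosedToSerre.

Variables (C : additive_category) (E : bifunctor C) (s : realization_data E).
Hypothesis hs : extriangulated s.
Variable F : closed_subbifunctor s.

Lemma defects_all (M : module C) : defects s (subext F) M -> all_defects s M.
Proof.
by move=> [A [B [X [d [x [y [p [_ hd hp]]]]]]]]; exists A, B, X, d, x, y, p.
Qed.

Lemma subext_presents (X A X' A' : C) (d : E X A) (d' : E X' A')
    (M : module C) (m : M X) (m' : M X') :
  presents d m -> presents d' m' -> F X' A' d' -> F X A d.
Proof.
move=> hm hm' Fd'; have [c [a ->]] := presents_change hs hm hm'.
exact/subext_push/subext_pull.
Qed.

Lemma defects_iso (M N : module C) (f : mod_hom M N) (g : mod_hom N M) :
  (forall A m, g A (f A m) = m) -> (forall A n, f A (g A n) = n) ->
  defects s (subext F) M -> defects s (subext F) N.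
Proof.
move=> gf fg /(defectsP hs) [X [A [d [m [Fd hm]]]]].
apply/(defectsP hs); exists X, A, d, (f X m); split=> //; split=> W.
  by move=> w; have [h hE] := hm.1 W (g W w); exists h; rewrite -mod_nat -hE fg.
move=> h; rewrite -mod_nat -(hm.2 W h).
by split=> [f0 | ->]; rewrite ?raddf0 // -[LHS]gf f0 raddf0.
Qed.

Lemma defects_zero (Z : module C) :
  (forall A (z : Z A), z = 0) -> defects s (subext F) Z.
Proof.
move=> Z0; apply/(defectsP hs); exists (zero_ob C), (zero_ob C), 0, 0.
split; first exact: subext0.
split=> [W w | W g]; first by exists 0; rewrite (Z0 W w) raddf0.
by rewrite pull0 raddf0.
Qed.

(** The generator of [L] maps to a multiple of that of [M] by some [c]; by injectivity [L] is also
    presented by [pull c d]. *)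
Lemma defects_sub (L M : module C) (f : mod_hom L M) :
  all_defects s L -> is_mono (all_defects s) f ->
  defects s (subext F) M -> defects s (subext F) L.
Proof.
move=> dL fmono dM.
have finj := mono_injective hs dL (defects_all dM) fmono.
move: dL dM => /(defectsP hs) [Y [B [e [l [_ hl]]]]].
move=> /(defectsP hs) [X [A [d [m [Fd hm]]]]].
have [c fl] := hm.1 Y (f Y l).
apply/(defectsP hs); exists Y, A, (pull c d), l; split.
  exact: subext_pull.
exact: presents_pull hm hl.1 finj fl.
Qed.

(** The image of the generator of [M] generates [N] with a larger annihilator, so the extension
    presenting it is a pushout of [d]. *)
Lemma defects_quot (M N : module C) (g : mod_hom M N) :
  all_defects s N -> is_epi (all_defects s) g ->
  defects s (subext F) M -> defects s (subext F) N.
Proof.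
move=> dN gepi dM.
have gsurj := epi_surjective hs (defects_all dM) dN gepi.
move: dN dM => /(defectsP hs) [Y [B [e [n [_ hn]]]]].
move=> /(defectsP hs) [X [A [d [m [Fd hm]]]]].
have [c hc] := presents_image hm hn gsurj.
apply/(defectsP hs); exists X, B, (pull c e), (g X m); split=> //.
have [|a ->] := @annihilator_le _ _ _ hs _ _ _ (pull c e) d.
  move=> W h /(hm.2 W) h0; apply/(hc.2 W).
  by rewrite -mod_nat h0 raddf0.
exact: subext_push.
Qed.

(* If [q] is an F-deflation and [pull q e] lies in F, then the composite of [q]
   with a deflation of [pull q e] is an F-deflation annihilating [e]. *)
Lemma subext_extension (Y A B P : C) (e : E Y A) (v : E Y B) (x : Hom B P)
    (q : Hom P Y) :
  F Y B v -> realizes s v x q -> F P A (pull q e) -> F Y A e.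
Proof.
move=> Fv hq Fqe; have [R [x' [r hr]]] := realization_exists hs (pull q e).
have [G [t [x'' [Ft ht]]]] : sub_deflation s (subext F) (q ∘ r).
  by apply: subext_closed; [exists A, (pull q e), x' | exists B, v, x].
have [|b ->] := pull_deflation_eq0 hs (e := e) ht.
  by rewrite pull_comp (pull_deflation hs hr).
exact: subext_push.
Qed.

Lemma defects_ext (L M N : module C) (f : mod_hom L M) (g : mod_hom M N) :
  all_defects s M -> is_kernel (all_defects s) f g ->
  is_cokernel (all_defects s) f g ->
  defects s (subext F) L -> defects s (subext F) N -> defects s (subext F) M.
Proof.
move=> dM fker gcok dL dN.
have finj := mono_injective hs (defects_all dL) dM (kernel_mono fker).
have gsurj := epi_surjective hs dM (defects_all dN) (cokernel_epi gcok).
move: dM dL dN => /(defectsP hs) [Y [A [e [m [_ hm]]]]].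
move=> /(defectsP hs) [X [D [d [l [Fd hl]]]]].
move=> /(defectsP hs) [Z [B [v [n [Fv hn]]]]].
have [c hc] := presents_image hm hn gsurj.
have [P [x [q hq]]] := realization_exists hs (pull c v).
have [||K [k [u [hk uinj gu0 ker]]]] :=
    kernel_presented (c := idm Y) (f := g) (x := x) (q := q) hs hm hc.
- by rewrite mod_map_id.
- by rewrite pull_id.
(* Both [K] and [L] are kernels of [g], so [w] is bijective and carries the generator of [K] to one
   of [L]: thus [pull q e] presents [L] and lies in [F]. *)
have [w [fw _]] := fker.2 K u (presents_all_defects hs hk) gu0.
have hwk : presents (pull q e) (w P k).
  split=> [W z | W h].
    have [|k' uk'] := ker W (f W z); first exact: fker.1.
    have [h hE] := hk.1 W k'; exists h; rewrite -mod_nat -hE.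
    apply/eqP; rewrite -subr_eq0; apply/eqP/finj.
    by rewrite raddfB fw uk' subrr.
  rewrite -(hk.2 W h) -mod_nat; split=> [w0 | ->]; last exact: raddf0.
  by apply: uinj; rewrite -fw w0 raddf0.
apply/(defectsP hs); exists Y, A, e, m; split=> //.
apply: (subext_extension (v := pull c v) (x := x) (q := q)) => //.
  exact: subext_pull.
exact: subext_presents hwk hl Fd.
Qed.

Definition serre_of_closed : serre_subcategory (all_defects s) :=
  SerreSubcategory defects_all defects_iso defects_zero defects_sub
    defects_quot defects_ext.

End ClosedToSerre.

(** * From Serre subcategories to closed subbifunctors *)

Section SerreToClosed.

Variables (C : additive_category) (E : bifunctor C) (s : realization_data E).
Hypothesis hs : extriangulated s.
Variable S : serre_subcategory (all_defects s).

(** Quantifying over all presented modules avoids choosing a defect; they exist and are isomorphic,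
    so testing one suffices. *)
Definition defect_in (X A : C) (d : E X A) : Prop :=
  forall (M : module C) (m : M X), presents d m -> S M.

Lemma defect_inP (X A : C) (d : E X A) (M : module C) (m : M X) :
  presents d m -> defect_in d <-> S M.
Proof.
move=> hm; split=> [Sd | SM N n hn]; first exact: Sd hm.
have [f [g [gf fg]]] := presents_iso hm hn.
exact: serre_iso gf fg SM.
Qed.

(** The defect of a pushout of [d] is a quotient of the defect of [d]. *)
Lemma defect_in_push (X A A' : C) (a : Hom A A') (d : E X A) :
  defect_in d -> defect_in (push a d).
Proof.
move=> Sd N n hn; have [M [m hm]] := presents_exists d.
have [|g gE] := hom_of_presents (n := n) hm.
  by move=> W h h0; apply/(hn.2 W); rewrite pull_push h0 push0.
apply: (serre_quot (g := g) (M := M)); last exact: Sd hm.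
  exact: (presents_all_defects hs hn).
apply: surjective_epi => W w; have [h ->] := hn.1 W w.
by exists (mod_map M h m); rewrite gE.
Qed.

(** The defect of a pullback of [d] embeds in the defect of [d]. *)
Lemma defect_in_pull (X X' A : C) (c : Hom X' X) (d : E X A) :
  defect_in d -> defect_in (pull c d).
Proof.
move=> Sd L l hl; have [M [m hm]] := presents_exists d.
have [|f fE] := hom_of_presents (n := mod_map M c m) hl.
  by move=> W h; rewrite -pull_comp -mod_map_comp; apply: (hm.2 W (c ∘ h)).2.
apply: (serre_sub (f := f) (M := M)); last exact: Sd hm.
  exact: (presents_all_defects hs hl).
apply: injective_mono => W w; have [h ->] := hl.1 W w.
rewrite fE -mod_map_comp => /(hm.2 W); rewrite pull_comp => h0.
exact/(hl.2 W).
Qed.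

(** The defects of [pull q e], [e] and [push a e], in this order, form a short exact sequence. *)
Lemma defect_in_extension (Y A B P : C) (e : E Y A) (a : Hom A B)
    (x : Hom B P) (q : Hom P Y) :
  realizes s (push a e) x q -> defect_in (push a e) -> defect_in (pull q e) ->
  defect_in e.
Proof.
move=> hq Sv Sqe M m hm; have [N [n hn]] := presents_exists (push a e).
have [|g gE] := hom_of_presents (n := n) hm.
  by move=> W h h0; apply/(hn.2 W); rewrite pull_push h0 push0.
have gm : g Y m = n by rewrite -[m]mod_map_id gE mod_map_id.
have [||K [k [u [hk uinj gu0 ker]]]] :=
    kernel_presented (c := idm Y) (f := g) (x := x) (q := q) hs hm hn.
- by rewrite mod_map_id.
- by rewrite pull_id.
apply: (serre_ext (f := u) (g := g)).
- exact: (presents_all_defects hs hm).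
- exact: exact_kernel.
- apply: exact_cokernel => // W w; have [h ->] := hn.1 W w.
  by exists (mod_map M h m); rewrite gE.
- exact: Sqe hk.
- exact: Sv hn.
Qed.

Lemma defect_in0 (X A : C) : defect_in (0 : E X A).
Proof.
move=> M m hm; apply: serre_zero => W w; have [g ->] := hm.1 W w.
by apply/(hm.2 W); rewrite pull0.
Qed.

(* [d + d'] is a pushout of [push in1 d + push in2 d'], which is an extension
   of [d] by a pullback of [push in2 d']. *)
Lemma defect_inD (X A : C) (d d' : E X A) :
  defect_in d -> defect_in d' -> defect_in (d + d').
Proof.
move=> Sd Sd'; have [B [x [y hd]]] := realization_exists hs d.
pose t := push (in1 A A) d + push (in2 A A) d'.
have dE : push (pr1 A A) t = d.
  by rewrite pushD -!push_comp pr1_in1 pr1_in2 push_id push0l addr0.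
have d'E : push (pr2 A A) t = d'.
  by rewrite pushD -!push_comp pr2_in1 pr2_in2 push_id push0l add0r.
have -> : d + d' = push (pr1 A A + pr2 A A) t by rewrite pushDl dE d'E.
apply: defect_in_push.
apply: (defect_in_extension (a := pr1 A A) (x := x) (q := y)); rewrite ?dE //.
rewrite pullD !pull_push (pull_deflation hs hd) push0 add0r -pull_push.
exact/defect_in_pull/defect_in_push.
Qed.

Lemma defect_inB (X A : C) (d d' : E X A) :
  defect_in d -> defect_in d' -> defect_in (d - d').
Proof.
move=> Sd Sd'; apply: defect_inD => //.
by rewrite -[d']push_id -pushNl; apply: defect_in_push.
Qed.

Lemma defect_in_closed (B X Y : C) (y : Hom B X) (z : Hom X Y) :
  sub_deflation s defect_in y -> sub_deflation s defect_in z ->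
  sub_deflation s defect_in (z ∘ y).
Proof.
move=> [A [d [x [Sd hd]]]] [A' [d' [x' [Sd' hd']]]].
(* Here [t] is realized with deflation [z ∘ y], [push e t] is [d'], and [pull z t] is [push i d]:
   both outer terms of the short exact sequence for [t] lie in [S]. *)
have [G [i [e [h [t [[_ _ ht] [_ et it]]]]]]] := ET4op hs hd hd'.
exists G, t, h; split=> //.
apply: (defect_in_extension (a := e) (x := x') (q := z)); rewrite ?et //.
by rewrite -it; apply: defect_in_push.
Qed.

Definition closed_of_serre : closed_subbifunctor s :=
  ClosedSubbifunctor defect_in0 defect_inB defect_in_push defect_in_pull
    defect_in_closed.

End SerreToClosed.

(** * Extensionality and the isomorphism of posets *)

Lemma closed_subbifunctor_ext (C : additive_category) (E : bifunctor C)
    (s : realization_data E) (F G : closed_subbifunctor s) :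
  (forall X A (d : E X A), F X A d <-> G X A d) -> F = G.
Proof.
case: F G => [F f0 fB fpush fpull fcl] [G g0 gB gpush gpull gcl] /= FG.
have {FG} FG : F = G.
  apply: functional_extensionality_dep => X.
  apply: functional_extensionality_dep => A.
  by apply: funext => d; apply: propext.
by subst G; congr ClosedSubbifunctor; apply: Prop_irrelevance.
Qed.

Lemma serre_subcategory_ext (C : additive_category) (P : module C -> Prop)
    (S T : serre_subcategory P) :
  (forall M, S M <-> T M) -> S = T.
Proof.
case: S T => [S s1 s2 s3 s4 s5 s6] [T t1 t2 t3 t4 t5 t6] /= ST.
have {ST} ST : S = T by apply: funext => M; apply: propext.
by subst T; congr SerreSubcategory; apply: Prop_irrelevance.
Qed.

Theorem theorem2 (C : additive_category) (E : bifunctor C)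
    (s : realization_data E) (hs : extriangulated s)
    (hC : skeletally_small C) :
  exists def : closed_subbifunctor s -> serre_subcategory (all_defects s),
    (forall (F : closed_subbifunctor s) (M : module C),
       serre (def F) M <-> defects s (subext F) M) /\
    poset_isomorphism (@subbifunctor_le C E s) (@serre_le C (all_defects s))
      def.
Proof.
(* Recovering [F] from its defects gives one of the two inverse laws and the reflection of
   inclusions. *)
have in_def (F : closed_subbifunctor s) (X A : C) (d : E X A) :
    F X A d <-> defect_in (serre_of_closed hs F) d.
  split=> [Fd M m hm | dF]; first by apply/(defectsP hs); exists X, A, d, m.
  have [M [m hm]] := presents_exists d.
  have /(defectsP hs) [X' [A' [d' [m' [Fd' hm']]]]] := dF M m hm.
  exact: (subext_presents hs hm hm' Fd').
exists (serre_of_closed hs); split=> //; split.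
  exists (closed_of_serre hs) => [F | S].
    apply: closed_subbifunctor_ext => X A d.
    exact: (iff_sym (in_def F X A d)).
  apply: serre_subcategory_ext => M; split=> [/(defectsP hs) | SM].
    by move=> [X [A [d [m [Sd hm]]]]]; apply: Sd hm.
  have /(defectsP hs) [X [A [d [m [_ hm]]]]] := serre_in SM.
  apply/(defectsP hs); exists X, A, d, m; split=> //.
  exact/(defect_inP S hm).
move=> F G; split=> [FG M | FG X A d /in_def dF].
  move=> /(defectsP hs) [X [A [d [m [Fd hm]]]]].
  by apply/(defectsP hs); exists X, A, d, m; split=> //; apply: FG.
by apply/in_def => M m hm; apply/FG/dF/hm.
Qed.
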